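(* Let $f^*\colon\mathcal{C}\to\mathcal{D}$ be a Gorenstein proxy-small geometric functor between rigidly-compactly generated tt-categories, with a geometric section $\eta^*\colon\mathcal{D}\to\mathcal{C}$. Then $f^*$ has Gorenstein duality if and only if $\eta^!(\omega_f)$ is an orientable Matlis lift of $\omega_f$.
   Context: A tt-category is a triangulated category with a compatible closed symmetric monoidal structure, with tensor $\otimes$, unit $\mathbb{1}_{\mathcal{C}}$, internal hom $\underline{\mathrm{Hom}}$, and $D=\underline{\mathrm{Hom}}(-,\mathbb{1})$. An object $M$ is rigid if the canonical map $DM\otimes N\to\underline{\mathrm{Hom}}(M,N)$ is an isomorphism for all $N$. A tt-category is rigidly-compactly generated if it is compactly generated and its rigid objects coincide with its compact objects. A geometric functor $f^*\colon\mathcal{C}\to\mathcal{D}$ between rigidly-compactly generated tt-categories is a strong symmetric monoidal, triangulated, coproduct-preserving functor; it has a right adjoint $f_*$, which has a right adjoint $f^!$. Put $\omega_f=f^!(\mathbb{1}_{\mathcal{C}})$. $\mathrm{Pic}(\mathcal{D})$ is the group of isomorphism classes of $\otimes$-invertible objects; $f^*$ is Gorenstein if $\omega_f\in\mathrm{Pic}(\mathcal{D})$. $\mathrm{thick}_\otimes(\mathcal{X})$ is the smallest thick subcategory containing $\mathcal{X}$ and closed under tensoring with rigid objects; $\mathrm{Loc}_\otimes(\mathcal{X})$ is the smallest localising subcategory containing $\mathcal{X}$ and closed under tensoring with arbitrary objects. The geometric functor $f^*$ is proxy-small if $f_*\mathbb{1}_{\mathcal{D}}$ is proxy-small, i.e.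 there is a set $\mathcal{W}$ of compact objects of $\mathcal{C}$ with $\mathcal{W}\subseteq\mathrm{thick}_\otimes(f_*\mathbb{1}_{\mathcal{D}})$ and $f_*\mathbb{1}_{\mathcal{D}}\in\mathrm{Loc}_\otimes(\mathcal{W})$. $\Gamma_f$ denotes the right adjoint of the inclusion $\Gamma_f\mathcal{C}=\mathrm{Loc}_\otimes(f_*\mathbb{1}_{\mathcal{D}})\hookrightarrow\mathcal{C}$. A geometric section of $f^*$ is a geometric functor $\eta^*\colon\mathcal{D}\to\mathcal{C}$ with $f^*\eta^*\simeq\mathrm{id}_{\mathcal{D}}$; it has adjoints $\eta^*\dashv\eta_*\dashv\eta^!$, and $\omega_\eta=\eta^!(\mathbb{1}_{\mathcal{D}})$. The functor $f^*$ with geometric section $\eta^*$ has Gorenstein duality if there is $X\in\mathrm{Pic}(\mathcal{D})$ with $\Gamma_f\omega_\eta\simeq\Gamma_f\eta^*(X)$. A Matlis lift of $Y\in\mathcal{D}$ is an object $X\in\mathcal{C}$ with $f^!X\simeq Y$. A Matlis lift $X$ of $\omega_f$ is orientable if $\Gamma_f X\simeq\Gamma_f\mathbb{1}_{\mathcal{C}}$. *)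

(* Defs.v *)
(* Tensor-triangulated categories.

   The library has no category theory, so the tower
     preadditive category < triangulated category < tt-category
   is set up here.  Hom-sets are [zmodType]s; "small" sets (index sets of
   coproducts, sets of generators) are [choiceType]s, so that their universe is
   the one of Hom-sets while objects live in an unrelated universe. *)
From mathcomp Require Import all_boot all_algebra.
From mathcomp Require Import boolp classical_sets functions cardinality fsbigop.

Set Implicit Arguments.
Unset Strict Implicit.
Unset Printing Implicit Defensive.

Import GRing.Theory.
Local Open Scope classical_set_scope.
Local Open Scope ring_scope.

Declare Scope cat_scope.
Delimit Scope cat_scope with cat.
Local Open Scope cat_scope.

Record preadditive := Preadditive {
  obj :> Type;
  hom : obj -> obj -> zmodType;
  idm : forall X, hom X X;
  compm : forall X Y Z, hom Y Z -> hom X Y -> hom X Z;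
  comp1m : forall X Y (f : hom X Y), compm (idm Y) f = f;
  compm1 : forall X Y (f : hom X Y), compm f (idm X) = f;
  compA : forall X Y Z W (h : hom Z W) (g : hom Y Z) (f : hom X Y),
    compm h (compm g f) = compm (compm h g) f;
  compDl : forall X Y Z (g g' : hom Y Z) (f : hom X Y),
    compm (g + g') f = compm g f + compm g' f;
  compDr : forall X Y Z (g : hom Y Z) (f f' : hom X Y),
    compm g (f + f') = compm g f + compm g f' }.

Arguments hom {_} _ _.
Arguments idm {_} _.
Arguments compm {_ _ _ _} _ _.

Notation "X ~> Y" := (hom X Y) (at level 55, no associativity) : cat_scope.
Notation "g ∘ f" := (compm g f) (at level 38, left associativity) : cat_scope.

Record iso (C : preadditive) (X Y : C) := Iso {
  iso_map : X ~> Y;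
  iso_inv : Y ~> X;
  iso_mapK : iso_inv ∘ iso_map = idm X;
  iso_invK : iso_map ∘ iso_inv = idm Y }.

Definition is_iso (C : preadditive) (X Y : C) (f : X ~> Y) : Prop :=
  exists g : Y ~> X, g ∘ f = idm X /\ f ∘ g = idm Y.

Definition isomorphic (C : preadditive) (X Y : C) : Prop := inhabited (iso X Y).

(* Additivity is not required of a functor; see [triangulated_functor]. *)
Record functor (C D : preadditive) := Functor {
  fobj :> C -> D;
  fmap : forall X Y : C, (X ~> Y) -> (fobj X ~> fobj Y);
  fmap_id : forall X : C, fmap (idm X) = idm (fobj X);
  fmap_comp : forall (X Y Z : C) (g : Y ~> Z) (f : X ~> Y),
    fmap (g ∘ f) = fmap g ∘ fmap f }.

Arguments fmap {_ _} _ {_ _} _.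

Definition functor_id (C : preadditive) : functor C C :=
  @Functor C C (fun X => X) (fun _ _ f => f)
    (fun _ => erefl) (fun _ _ _ _ _ => erefl).

Section Composition.
Variables (C D E : preadditive) (G : functor D E) (F : functor C D).

Lemma functor_comp_id (X : C) : fmap G (fmap F (idm X)) = idm (G (F X)).
Proof. by rewrite !fmap_id. Qed.

Lemma functor_comp_comp (X Y Z : C) (g : Y ~> Z) (f : X ~> Y) :
  fmap G (fmap F (g ∘ f)) = fmap G (fmap F g) ∘ fmap G (fmap F f).
Proof. by rewrite !fmap_comp. Qed.

Definition functor_comp : functor C E :=
  @Functor C E (fun X => G (F X)) (fun _ _ f => fmap G (fmap F f))
    functor_comp_id functor_comp_comp.
End Composition.

Record nat_trans (C D : preadditive) (F G : functor C D) := NatTrans {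
  nt_map :> forall X : C, F X ~> G X;
  nt_natural : forall (X Y : C) (f : X ~> Y),
    nt_map Y ∘ fmap F f = fmap G f ∘ nt_map X }.

Record nat_iso (C D : preadditive) (F G : functor C D) := NatIso {
  ni_iso :> forall X : C, iso (F X) (G X);
  ni_natural : forall (X Y : C) (f : X ~> Y),
    iso_map (ni_iso Y) ∘ fmap F f = fmap G f ∘ iso_map (ni_iso X) }.

(* [adjunction F G] : F is left adjoint to G. *)
Record adjunction (C D : preadditive) (F : functor C D) (G : functor D C) :=
  Adjunction {
    adj_unit : nat_trans (functor_id C) (functor_comp G F);
    adj_counit : nat_trans (functor_comp F G) (functor_id D);
    adj_triangleL : forall X : C,
      adj_counit (F X) ∘ fmap F (adj_unit X) = idm (F X);
    adj_triangleR : forall Y : D,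
      fmap G (adj_counit Y) ∘ adj_unit (G Y) = idm (G Y) }.

Section FullSubcategory.
Variables (C : preadditive) (P : C -> Prop).

Definition full_subcategory : preadditive :=
  @Preadditive {X : C | P X} (fun X Y => sval X ~> sval Y)
    (fun X => idm (sval X)) (fun _ _ _ g f => g ∘ f)
    (fun _ _ f => comp1m f) (fun _ _ f => compm1 f)
    (fun _ _ _ _ h g f => compA h g f)
    (fun _ _ _ g g' f => compDl g g' f) (fun _ _ _ g f f' => compDr g f f').

Definition inclusion : functor full_subcategory C :=
  @Functor full_subcategory C (fun X => sval X) (fun _ _ f => f)
    (fun _ => erefl) (fun _ _ _ _ _ => erefl).
End FullSubcategory.

Definition is_zero (C : preadditive) (Z : C) : Prop := idm Z = 0.

Definition is_biproduct (C : preadditive) (X Y P : C)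
    (i1 : X ~> P) (i2 : Y ~> P) (p1 : P ~> X) (p2 : P ~> Y) : Prop :=
  [/\ p1 ∘ i1 = idm X, p2 ∘ i2 = idm Y, p1 ∘ i2 = 0, p2 ∘ i1 = 0
    & i1 ∘ p1 + i2 ∘ p2 = idm P].

Definition is_coproduct (C : preadditive) (I : choiceType) (X : I -> C)
    (P : C) (inj : forall i, X i ~> P) : Prop :=
  forall (Y : C) (f : forall i, X i ~> Y),
    exists! g : P ~> Y, forall i, g ∘ inj i = f i.

Definition has_coproducts (C : preadditive) : Prop :=
  forall (I : choiceType) (X : I -> C),
    exists (P : C) (inj : forall i, X i ~> P), is_coproduct inj.

Definition preserves_coproducts (C D : preadditive) (F : functor C D) : Prop :=
  forall (I : choiceType) (X : I -> C) (P : C) (inj : forall i, X i ~> P),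
    is_coproduct inj -> is_coproduct (fun i => fmap F (inj i)).

(* The canonical map from the direct sum of the Hom(K, X_i) (families with
   finite support) to Hom(K, ∐ X_i) is bijective. *)
Definition compact (C : preadditive) (K : C) : Prop :=
  forall (I : choiceType) (X : I -> C) (P : C) (inj : forall i, X i ~> P),
    is_coproduct inj ->
    forall g : K ~> P, exists! h : (forall i, K ~> X i),
      finite_set [set i | h i != 0] /\ g = \sum_(i \in setT) (inj i ∘ h i).

Record triangulation (C : preadditive) := Triangulation {
  shift : functor C C;
  unshift : functor C C;
  shiftK : nat_iso (functor_comp unshift shift) (functor_id C);
  unshiftK : nat_iso (functor_comp shift unshift) (functor_id C);
  shiftD : forall (X Y : C) (f g : X ~> Y),
    fmap shift (f + g) = fmap shift f + fmap shift g;
  has_zero : exists Z : C, is_zero Z;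
  has_biproducts : forall X Y : C,
    exists (P : C) (i1 : X ~> P) (i2 : Y ~> P) (p1 : P ~> X) (p2 : P ~> Y),
      is_biproduct i1 i2 p1 p2;
  dist : forall X Y Z : C, (X ~> Y) -> (Y ~> Z) -> (Z ~> shift X) -> Prop;
  dist_iso : forall (X Y Z X' Y' Z' : C)
      (f : X ~> Y) (g : Y ~> Z) (h : Z ~> shift X)
      (f' : X' ~> Y') (g' : Y' ~> Z') (h' : Z' ~> shift X')
      (a : X ~> X') (b : Y ~> Y') (c : Z ~> Z'),
    is_iso a -> is_iso b -> is_iso c ->
    b ∘ f = f' ∘ a -> c ∘ g = g' ∘ b -> fmap shift a ∘ h = h' ∘ c ->
    dist f g h -> dist f' g' h';
  dist_id : forall X Z : C, is_zero Z ->
    dist (idm X) (0 : X ~> Z) (0 : Z ~> shift X);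
  dist_complete : forall (X Y : C) (f : X ~> Y),
    exists (Z : C) (g : Y ~> Z) (h : Z ~> shift X), dist f g h;
  dist_rotate : forall (X Y Z : C)
      (f : X ~> Y) (g : Y ~> Z) (h : Z ~> shift X),
    dist f g h <-> dist g h (- fmap shift f);
  dist_fill : forall (X Y Z X' Y' Z' : C)
      (f : X ~> Y) (g : Y ~> Z) (h : Z ~> shift X)
      (f' : X' ~> Y') (g' : Y' ~> Z') (h' : Z' ~> shift X')
      (a : X ~> X') (b : Y ~> Y'),
    dist f g h -> dist f' g' h' -> b ∘ f = f' ∘ a ->
    exists c : Z ~> Z', c ∘ g = g' ∘ b /\ fmap shift a ∘ h = h' ∘ c;
  dist_octahedral : forall (X Y Z A B E : C) (f : X ~> Y) (g : Y ~> Z)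
      (i : Y ~> A) (i' : A ~> shift X)
      (j : Z ~> B) (j' : B ~> shift Y)
      (k : Z ~> E) (k' : E ~> shift X),
    dist f i i' -> dist g j j' -> dist (g ∘ f) k k' ->
    exists (u : A ~> E) (v : E ~> B),
      [/\ dist u v (fmap shift i ∘ j'),
          u ∘ i = k ∘ g, k' ∘ u = i', v ∘ k = j
        & j' ∘ v = fmap shift f ∘ k'] }.

Arguments dist {_} _ {_ _ _} _ _ _.

Definition shiftz (C : preadditive) (T : triangulation C) (n : int) (X : C) : C :=
  match n with
  | Posz m => iter m (shift T) X
  | Negz m => iter m.+1 (unshift T) X
  end.

Definition compactly_generated (C : preadditive) (T : triangulation C) : Prop :=
  has_coproducts C /\
  exists (J : choiceType) (G : J -> C),
    (forall j, compact (G j)) /\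
    (forall X : C, (forall j n (f : G j ~> shiftz T n X), f = 0) -> is_zero X).

Record csm_data (C : preadditive) := CsmData {
  tens : C -> C -> C;
  tmap : forall X X' Y Y' : C, (X ~> X') -> (Y ~> Y') -> (tens X Y ~> tens X' Y');
  tunit : C;
  associator : forall X Y Z : C, iso (tens (tens X Y) Z) (tens X (tens Y Z));
  unitorl : forall X : C, iso (tens tunit X) X;
  unitorr : forall X : C, iso (tens X tunit) X;
  braiding : forall X Y : C, iso (tens X Y) (tens Y X);
  ihom : C -> C -> C;
  ev : forall X Y : C, tens (ihom X Y) X ~> Y;
  curry : forall A X Y : C, (tens A X ~> Y) -> (A ~> ihom X Y) }.

Arguments tens {_} _ _ _.
Arguments tmap {_} _ {_ _ _ _} _ _.
Arguments tunit {_} _.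
Arguments associator {_} _ _ _ _.
Arguments unitorl {_} _ _.
Arguments unitorr {_} _ _.
Arguments braiding {_} _ _ _.
Arguments ihom {_} _ _ _.
Arguments ev {_} _ _ _.
Arguments curry {_} _ {_ _ _} _.

Section CsmLaws.
Variables (C : preadditive) (M : csm_data C).
Local Notation "X ⊗ Y" := (tens M X Y) (at level 37, right associativity).
Local Notation "f ⊠ g" := (tmap M f g) (at level 37, right associativity).
Local Notation α X Y Z := (iso_map (associator M X Y Z)).
Local Notation λ X := (iso_map (unitorl M X)).
Local Notation ρ X := (iso_map (unitorr M X)).
Local Notation τ X Y := (iso_map (braiding M X Y)).

Record csm_laws : Prop := CsmLaws {
  tmap_id : forall X Y : C, idm X ⊠ idm Y = idm (X ⊗ Y);
  tmap_comp : forall (X X' X'' Y Y' Y'' : C)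
      (f : X ~> X') (f' : X' ~> X'') (g : Y ~> Y') (g' : Y' ~> Y''),
    (f' ∘ f) ⊠ (g' ∘ g) = (f' ⊠ g') ∘ (f ⊠ g);
  tmapDl : forall (X X' Y Y' : C) (f f' : X ~> X') (g : Y ~> Y'),
    (f + f') ⊠ g = f ⊠ g + f' ⊠ g;
  tmapDr : forall (X X' Y Y' : C) (f : X ~> X') (g g' : Y ~> Y'),
    f ⊠ (g + g') = f ⊠ g + f ⊠ g';
  associator_natural : forall (X X' Y Y' Z Z' : C)
      (f : X ~> X') (g : Y ~> Y') (h : Z ~> Z'),
    α X' Y' Z' ∘ ((f ⊠ g) ⊠ h) = (f ⊠ (g ⊠ h)) ∘ α X Y Z;
  unitorl_natural : forall (X X' : C) (f : X ~> X'),
    λ X' ∘ (idm (tunit M) ⊠ f) = f ∘ λ X;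
  unitorr_natural : forall (X X' : C) (f : X ~> X'),
    ρ X' ∘ (f ⊠ idm (tunit M)) = f ∘ ρ X;
  braiding_natural : forall (X X' Y Y' : C) (f : X ~> X') (g : Y ~> Y'),
    τ X' Y' ∘ (f ⊠ g) = (g ⊠ f) ∘ τ X Y;
  pentagon : forall X Y Z W : C,
    α X Y (Z ⊗ W) ∘ α (X ⊗ Y) Z W
      = (idm X ⊠ α Y Z W) ∘ α X (Y ⊗ Z) W ∘ (α X Y Z ⊠ idm W);
  triangle : forall X Y : C,
    (idm X ⊠ λ Y) ∘ α X (tunit M) Y = ρ X ⊠ idm Y;
  hexagon : forall X Y Z : C,
    (idm Y ⊠ τ X Z) ∘ α Y X Z ∘ (τ X Y ⊠ idm Z)
      = α Y Z X ∘ τ X (Y ⊗ Z) ∘ α X Y Z;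
  symmetry : forall X Y : C, τ Y X ∘ τ X Y = idm (X ⊗ Y);
  curryK : forall (A X Y : C) (f : A ⊗ X ~> Y),
    ev M X Y ∘ (curry M f ⊠ idm X) = f;
  ev_curry : forall (A X Y : C) (g : A ~> ihom M X Y),
    curry M (ev M X Y ∘ (g ⊠ idm X)) = g }.

Definition ihom_post (W X Y : C) (f : X ~> Y) : ihom M W X ~> ihom M W Y :=
  curry M (f ∘ ev M W X).

Definition ihom_pre (W X Y : C) (f : X ~> Y) : ihom M Y W ~> ihom M X W :=
  curry M (ev M Y W ∘ (idm (ihom M Y W) ⊠ f)).
End CsmLaws.

(* Compatibility in the sense of Hovey-Palmieri-Strickland, Axiomatic stable
   homotopy theory, Definition A.2.1. *)
Section Compatibility.
Variables (C : preadditive) (T : triangulation C) (M : csm_data C).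
Local Notation "X ⊗ Y" := (tens M X Y) (at level 37, right associativity).
Local Notation "f ⊠ g" := (tmap M f g) (at level 37, right associativity).
Local Notation S := (shift T).

Section Comparison.
Variable e : forall X Y : C, iso (S X ⊗ Y) (S (X ⊗ Y)).

(* Inverse of the comparison A ⊗ SX -> S(A ⊗ X) conjugate to e under the
   symmetry. *)
Definition shift_tensr_inv (A X : C) : S (A ⊗ X) ~> A ⊗ S X :=
  iso_map (braiding M (S X) A) ∘ iso_inv (e X A)
    ∘ fmap S (iso_map (braiding M A X)).

(* The canonical maps S[W,X] -> [W,SX] and S[SX,W] -> [X,W]; both are
   invertible, which is why the third maps of the triangles in [tt_ihom_post]
   and [tt_ihom_pre] are determined by the equations imposed there. *)
Definition shift_ihom_post (W X : C) : S (ihom M W X) ~> ihom M W (S X) :=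
  curry M (fmap S (ev M W X) ∘ iso_map (e (ihom M W X) W)).

Definition shift_ihom_pre (X W : C) : S (ihom M (S X) W) ~> ihom M X W :=
  curry M (ev M (S X) W ∘ shift_tensr_inv (ihom M (S X) W) X
             ∘ iso_map (e (ihom M (S X) W) X)).
End Comparison.

Record compatibility := Compatibility {
  tt_shift : forall X Y : C, iso (S X ⊗ Y) (S (X ⊗ Y));
  tt_shift_natural : forall (X X' Y Y' : C) (f : X ~> X') (g : Y ~> Y'),
    iso_map (tt_shift X' Y') ∘ (fmap S f ⊠ g)
      = fmap S (f ⊠ g) ∘ iso_map (tt_shift X Y);
  tt_shift_unit : forall X : C,
    fmap S (iso_map (unitorr M X)) ∘ iso_map (tt_shift X (tunit M))
      = iso_map (unitorr M (S X));
  tt_shift_assoc : forall X Y Z : C,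
    fmap S (iso_map (associator M X Y Z)) ∘ iso_map (tt_shift (X ⊗ Y) Z)
        ∘ (iso_map (tt_shift X Y) ⊠ idm Z)
      = iso_map (tt_shift X (Y ⊗ Z)) ∘ iso_map (associator M (S X) Y Z);
  tt_tens : forall (X Y Z W : C) (f : X ~> Y) (g : Y ~> Z) (h : Z ~> S X),
    dist T f g h ->
    dist T (f ⊠ idm W) (g ⊠ idm W) (iso_map (tt_shift X W) ∘ (h ⊠ idm W));
  tt_ihom_post : forall (X Y Z W : C) (f : X ~> Y) (g : Y ~> Z) (h : Z ~> S X)
      (d : ihom M W Z ~> S (ihom M W X)),
    dist T f g h ->
    shift_ihom_post tt_shift W X ∘ d = ihom_post M W h ->
    dist T (ihom_post M W f) (ihom_post M W g) d;
  tt_ihom_pre : forall (X Y Z W : C) (f : X ~> Y) (g : Y ~> Z) (h : Z ~> S X)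
      (d : ihom M X W ~> S (ihom M Z W)),
    dist T f g h ->
    d ∘ shift_ihom_pre tt_shift X W = fmap S (ihom_pre M W h) ->
    dist T (ihom_pre M W g) (ihom_pre M W f) d;
  (* The graded commutativity of the spheres S^r 1, in degrees r = s = 1; by
     coherence it implies the sign (-1)^(rs) on S^r 1 ⊗ S^s 1. *)
  tt_sign : iso_map (braiding M (S (tunit M)) (S (tunit M)))
              = - idm (S (tunit M) ⊗ S (tunit M)) }.
End Compatibility.

Record ttCategory := TtCategory {
  tt_cat :> preadditive;
  tt_tri : triangulation tt_cat;
  tt_mon : csm_data tt_cat;
  tt_laws : csm_laws tt_mon;
  tt_compat : compatibility tt_tri tt_mon }.

Notation Shift := (shift (tt_tri _)).
Notation Unshift := (unshift (tt_tri _)).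
Notation "X ⊗ Y" := (tens (tt_mon _) X Y)
  (at level 37, right associativity) : cat_scope.
Notation "f ⊠ g" := (tmap (tt_mon _) f g)
  (at level 37, right associativity) : cat_scope.
Notation "𝟙" := (tunit (tt_mon _)) : cat_scope.

Section TtNotions.
Variable C : ttCategory.

Definition dual (X : C) : C := ihom (tt_mon C) X 𝟙.

(* The canonical map DX ⊗ N -> [X, N], adjunct to
   (DX ⊗ N) ⊗ X = DX ⊗ (N ⊗ X) = DX ⊗ (X ⊗ N) = (DX ⊗ X) ⊗ N -> 1 ⊗ N = N. *)
Definition dual_tens_ihom (X N : C) : dual X ⊗ N ~> ihom (tt_mon C) X N :=
  curry (tt_mon C)
    (iso_map (unitorl (tt_mon C) N)
      ∘ (ev (tt_mon C) X 𝟙 ⊠ idm N)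
      ∘ iso_inv (associator (tt_mon C) (dual X) X N)
      ∘ (idm (dual X) ⊠ iso_map (braiding (tt_mon C) N X))
      ∘ iso_map (associator (tt_mon C) (dual X) N X)).

Definition rigid (X : C) : Prop := forall N : C, is_iso (dual_tens_ihom X N).

Definition invertible (X : C) : Prop := exists Y : C, isomorphic (X ⊗ Y) 𝟙.

Definition rigidly_compactly_generated : Prop :=
  compactly_generated (tt_tri C) /\ forall X : C, rigid X <-> compact X.

Record triangulated_subcat (P : C -> Prop) : Prop := TriangulatedSubcat {
  sub_iso : forall X Y : C, isomorphic X Y -> P X -> P Y;
  sub_zero : forall Z : C, is_zero Z -> P Z;
  sub_shift : forall X : C, P X -> P (Shift X);
  sub_unshift : forall X : C, P X -> P (Unshift X);
  sub_cone : forall (X Y Z : C) (f : X ~> Y) (g : Y ~> Z) (h : Z ~> Shift X),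
    dist (tt_tri C) f g h -> P X -> P Y -> P Z }.

Definition thick (P : C -> Prop) : Prop :=
  triangulated_subcat P /\
  forall (X Y : C) (s : X ~> Y) (r : Y ~> X), r ∘ s = idm X -> P Y -> P X.

Definition localising (P : C -> Prop) : Prop :=
  triangulated_subcat P /\
  forall (I : choiceType) (X : I -> C) (Q : C) (inj : forall i, X i ~> Q),
    is_coproduct inj -> (forall i, P (X i)) -> P Q.

Definition thick_tens (E : C -> Prop) (X : C) : Prop :=
  forall P : C -> Prop, thick P ->
    (forall R Y : C, rigid R -> P Y -> P (R ⊗ Y)) ->
    (forall Y, E Y -> P Y) -> P X.

Definition Loc_tens (E : C -> Prop) (X : C) : Prop :=
  forall P : C -> Prop, localising P ->
    (forall A Y : C, P Y -> P (A ⊗ Y)) ->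
    (forall Y, E Y -> P Y) -> P X.

Definition proxy_small (A : C) : Prop :=
  exists (J : choiceType) (W : J -> C),
    [/\ forall j, compact (W j),
        forall j, thick_tens (fun Y => Y = A) (W j)
      & Loc_tens (fun Y => exists j, Y = W j) A].
End TtNotions.

Record strong_symmetric_monoidal (C D : ttCategory) (F : functor C D) :=
  StrongSymmetricMonoidal {
    mon_unit : iso 𝟙 (F 𝟙);
    mon_tens : forall X Y : C, iso (F X ⊗ F Y) (F (X ⊗ Y));
    mon_natural : forall (X X' Y Y' : C) (f : X ~> X') (g : Y ~> Y'),
      iso_map (mon_tens X' Y') ∘ (fmap F f ⊠ fmap F g)
        = fmap F (f ⊠ g) ∘ iso_map (mon_tens X Y);
    mon_assoc : forall X Y Z : C,
      fmap F (iso_map (associator (tt_mon C) X Y Z))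
          ∘ iso_map (mon_tens (X ⊗ Y) Z) ∘ (iso_map (mon_tens X Y) ⊠ idm (F Z))
        = iso_map (mon_tens X (Y ⊗ Z)) ∘ (idm (F X) ⊠ iso_map (mon_tens Y Z))
          ∘ iso_map (associator (tt_mon D) (F X) (F Y) (F Z));
    mon_unitl : forall X : C,
      fmap F (iso_map (unitorl (tt_mon C) X)) ∘ iso_map (mon_tens 𝟙 X)
          ∘ (iso_map mon_unit ⊠ idm (F X))
        = iso_map (unitorl (tt_mon D) (F X));
    mon_unitr : forall X : C,
      fmap F (iso_map (unitorr (tt_mon C) X)) ∘ iso_map (mon_tens X 𝟙)
          ∘ (idm (F X) ⊠ iso_map mon_unit)
        = iso_map (unitorr (tt_mon D) (F X));
    mon_sym : forall X Y : C,
      fmap F (iso_map (braiding (tt_mon C) X Y)) ∘ iso_map (mon_tens X Y)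
        = iso_map (mon_tens Y X)
          ∘ iso_map (braiding (tt_mon D) (F X) (F Y)) }.

Record triangulated_functor (C D : ttCategory) (F : functor C D) :=
  TriangulatedFunctor {
    tri_add : forall (X Y : C) (f g : X ~> Y),
      fmap F (f + g) = fmap F f + fmap F g;
    tri_shift : forall X : C, iso (F (Shift X)) (Shift (F X));
    tri_shift_natural : forall (X Y : C) (f : X ~> Y),
      iso_map (tri_shift Y) ∘ fmap F (fmap Shift f)
        = fmap Shift (fmap F f) ∘ iso_map (tri_shift X);
    tri_dist : forall (X Y Z : C) (f : X ~> Y) (g : Y ~> Z) (h : Z ~> Shift X),
      dist (tt_tri C) f g h ->
      dist (tt_tri D) (fmap F f) (fmap F g) (iso_map (tri_shift X) ∘ fmap F h) }.

Record geometric_functor (C D : ttCategory) := GeometricFunctor {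
  geom_functor :> functor C D;
  geom_monoidal : strong_symmetric_monoidal geom_functor;
  geom_triangulated : triangulated_functor geom_functor;
  geom_coproducts : preserves_coproducts geom_functor }.

(* In what follows [f_] and [f_sh] stand for f_* and f^!. *)

Definition omega (C D : ttCategory) (f_sh : functor C D) : D := f_sh 𝟙.

Definition Gorenstein (C D : ttCategory) (f_sh : functor C D) : Prop :=
  invertible (omega f_sh).

Definition proxy_small_functor (C D : ttCategory) (f_ : functor D C) : Prop :=
  proxy_small (f_ 𝟙).

Definition geometric_section (C D : ttCategory)
    (f : geometric_functor C D) (eta : geometric_functor D C) : Prop :=
  inhabited (nat_iso (functor_comp f eta) (functor_id D)).

Definition torsion (C D : ttCategory) (f_ : functor D C) : preadditive :=
  full_subcategory (Loc_tens (fun Y : C => Y = f_ 𝟙)).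

Definition torsion_incl (C D : ttCategory) (f_ : functor D C) :
  functor (torsion f_) C := inclusion (Loc_tens (fun Y : C => Y = f_ 𝟙)).

Definition Gorenstein_duality (C D : ttCategory) (f_ : functor D C)
    (Gamma : functor C (torsion f_))
    (eta : geometric_functor D C) (eta_sh : functor D C) : Prop :=
  exists X : D, invertible X /\
    isomorphic (Gamma (omega eta_sh)) (Gamma (eta X)).

Definition Matlis_lift (C D : ttCategory) (f_sh : functor C D)
    (Y : D) (X : C) : Prop :=
  isomorphic (f_sh X) Y.

Definition orientable_Matlis_lift (C D : ttCategory) (f_ : functor D C)
    (f_sh : functor C D) (Gamma : functor C (torsion f_)) (X : C) : Prop :=
  Matlis_lift f_sh (omega f_sh) X /\ isomorphic (Gamma X) (Gamma 𝟙).

(* Main.v *)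
From mathcomp Require Import ssreflect ssrfun ssralg boolp.
Require Import Defs.

Set Implicit Arguments.
Unset Strict Implicit.
Unset Printing Implicit Defensive.

Local Open Scope cat_scope.

(** Write f^* for f, f_* for f_ and f^! for f_sh, and likewise for eta.

    The argument rests on one formal fact about adjunctions, [mate_nat_iso]: if
    equivalences S and T intertwine two left adjoints up to natural isomorphism,
    then they intertwine the right adjoints.  Three instances of it are used.
    - For P invertible, - ⊗ P is an equivalence, and f^* intertwines - ⊗ P with
      - ⊗ f^*P because it is strong monoidal.  Passing to right adjoints twice
      gives f^!(Y ⊗ P) ≅ f^!Y ⊗ f^*P ([shriek_twist]), and the same for eta.
    - Torsion objects form a tensor ideal, so their inclusion into C commutes
      with - ⊗ P; hence so does its right adjoint Gamma ([Gamma_twist]).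
    - Passing to right adjoints twice in f^* eta^* ≅ id gives f^! eta^! ≅ id
      ([shriek_section]).  Thus eta^!(omega_f) is always a Matlis lift of
      omega_f, and only its orientability is at stake.

    One more ingredient compares f^! with Gamma: f^! Gamma ≅ f^!
    ([shriek_Gamma]).  By adjunction this says that objects of the form f_*A do
    not distinguish Gamma Y from Y, which holds because f_*A is a retract of the
    torsion object f_*𝟙 ⊗ f_*A.

    By the first point, eta^!(omega_f) ≅ omega_eta ⊗ eta^*(omega_f).  Suppose
    Gamma omega_eta ≅ Gamma eta^*X with X invertible.  Applying f^! yields
    𝟙 ≅ f^! eta^! 𝟙 ≅ f^! eta^* X ≅ omega_f ⊗ X, so X is the inverse of omega_f;
    then twisting the assumed isomorphism by eta^*(omega_f) turns it into
    Gamma eta^!(omega_f) ≅ Gamma 𝟙.  Conversely, twisting the latter isomorphism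
    by the eta^* of an inverse W of omega_f gives Gamma omega_eta ≅
    Gamma eta^*W. *)

(** * Isomorphisms *)

Section Isomorphisms.
Variable C : preadditive.

Definition iso_sym (X Y : C) (i : iso X Y) : iso Y X :=
  Iso (iso_invK i) (iso_mapK i).

Lemma iso_mapKl (X Y W : C) (i : iso X Y) (x : W ~> X) :
  iso_inv i ∘ (iso_map i ∘ x) = x.
Proof. by rewrite compA iso_mapK comp1m. Qed.

Lemma iso_invKl (X Y W : C) (i : iso X Y) (x : W ~> Y) :
  iso_map i ∘ (iso_inv i ∘ x) = x.
Proof. by rewrite compA iso_invK comp1m. Qed.

Lemma iso_mapKr (X Y W : C) (i : iso X Y) (x : X ~> W) :
  x ∘ iso_inv i ∘ iso_map i = x.
Proof. by rewrite -compA iso_mapK compm1. Qed.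

Lemma iso_invKr (X Y W : C) (i : iso X Y) (x : Y ~> W) :
  x ∘ iso_map i ∘ iso_inv i = x.
Proof. by rewrite -compA iso_invK compm1. Qed.

Lemma isomorphic_refl (X : C) : isomorphic X X.
Proof. by split; exists (idm X) (idm X); rewrite comp1m. Qed.

Lemma isomorphic_sym (X Y : C) : isomorphic X Y -> isomorphic Y X.
Proof. by case=> i; split; apply: iso_sym. Qed.

Lemma isomorphic_trans (X Y Z : C) :
  isomorphic X Y -> isomorphic Y Z -> isomorphic X Z.
Proof.
move=> [i] [j]; split.
exists (iso_map j ∘ iso_map i) (iso_inv i ∘ iso_inv j).
- by rewrite -compA iso_mapKl iso_mapK.
- by rewrite -compA iso_invKl iso_invK.
Qed.

Lemma is_iso_isomorphic (X Y : C) (u : X ~> Y) : is_iso u -> isomorphic X Y.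
Proof. by case=> v [vu uv]; split; exists u v. Qed.

End Isomorphisms.

Lemma isomorphic_fobj (C D : preadditive) (F : functor C D) (X Y : C) :
  isomorphic X Y -> isomorphic (F X) (F Y).
Proof.
case=> i; split; exists (fmap F (iso_map i)) (fmap F (iso_inv i)).
- by rewrite -fmap_comp iso_mapK fmap_id.
- by rewrite -fmap_comp iso_invK fmap_id.
Qed.

Lemma nat_iso_of_is_iso (C D : preadditive) (F G : functor C D)
    (t : nat_trans F G) :
  (forall X, is_iso (t X)) -> inhabited (nat_iso F G).
Proof.
move=> t_iso; split.
pose i X := let: exist v (conj vt tv) := cid (t_iso X) in Iso vt tv.
have iE X : iso_map (i X) = t X by rewrite /i; case: cid => v [].
by exists i => X Y f; rewrite !iE nt_natural.
Qed.

(** * Equivalences and mates *)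

(** In this form only [eqv_surj] needs an argument when a functor is restricted
    to a full subcategory: the Hom-sets do not change. *)
Record equivalence (C D : preadditive) (S : functor C D) : Prop := Equivalence {
  eqv_faithful : forall (X Y : C) (f g : X ~> Y), fmap S f = fmap S g -> f = g;
  eqv_full : forall (X Y : C) (h : S X ~> S Y), exists f : X ~> Y, fmap S f = h;
  eqv_surj : forall Y : D, exists X : C, isomorphic (S X) Y }.

Lemma retraction_faithful (C D : preadditive) (S : functor C D)
    (S' : functor D C) (alpha : nat_iso (functor_comp S' S) (functor_id C)) :
  forall (X Y : C) (f g : X ~> Y), fmap S f = fmap S g -> f = g.
Proof.
move=> X Y f g e.
have /= nf := ni_natural alpha f; have /= ng := ni_natural alpha g.
by rewrite -(iso_invKr (alpha X) f) -nf e ng iso_invKr.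
Qed.

(** Fullness: a map h : SX -> SY has a candidate preimage, obtained by
    transporting S'h along alpha; it is a preimage because S' is faithful. *)
Lemma quasi_inverse_equivalence (C D : preadditive) (S : functor C D)
    (S' : functor D C) (alpha : nat_iso (functor_comp S' S) (functor_id C))
    (beta : nat_iso (functor_comp S S') (functor_id D)) :
  equivalence S.
Proof.
split.
- exact: retraction_faithful alpha.
- move=> X Y h.
  exists (iso_map (alpha Y) ∘ fmap S' h ∘ iso_inv (alpha X)).
  apply: (retraction_faithful beta).
  set f := _ ∘ iso_inv _.
  have /= nf := ni_natural alpha f.
  by rewrite -(iso_mapKl (alpha Y) (fmap S' (fmap S f))) nf /f iso_mapKr iso_mapKl.
- by move=> Y; exists (S' Y); split; exact: beta.
Qed.

Lemma equivalence_id (C : preadditive) : equivalence (functor_id C).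
Proof.
split=> //= [X Y h | Y]; first by exists h.
by exists Y; exact: isomorphic_refl.
Qed.

Section Transposition.
Variables (C D : preadditive) (F : functor C D) (G : functor D C).
Variable adj : adjunction F G.

Definition transpose (X : C) (Y : D) (h : F X ~> Y) : X ~> G Y :=
  fmap G h ∘ adj_unit adj X.

Definition untranspose (X : C) (Y : D) (k : X ~> G Y) : F X ~> Y :=
  adj_counit adj Y ∘ fmap F k.

Lemma transposeK (X : C) (Y : D) (h : F X ~> Y) : untranspose (transpose h) = h.
Proof.
have /= n := nt_natural (adj_counit adj) h.
by rewrite /untranspose /transpose fmap_comp compA n -compA adj_triangleL compm1.
Qed.

Lemma untransposeK (X : C) (Y : D) (k : X ~> G Y) :
  transpose (untranspose k) = k.
Proof.
have /= n := nt_natural (adj_unit adj) k.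
by rewrite /untranspose /transpose fmap_comp -compA -n compA adj_triangleR comp1m.
Qed.

Lemma transpose_natl (X X' : C) (Y : D) (h : F X ~> Y) (x : X' ~> X) :
  transpose h ∘ x = transpose (h ∘ fmap F x).
Proof.
have /= n := nt_natural (adj_unit adj) x.
by rewrite /transpose fmap_comp -!compA -n.
Qed.

Lemma transpose_natr (X : C) (Y Y' : D) (h : F X ~> Y) (y : Y ~> Y') :
  fmap G y ∘ transpose h = transpose (y ∘ h).
Proof. by rewrite /transpose fmap_comp compA. Qed.

Lemma untranspose_natl (X X' : C) (Y : D) (k : X ~> G Y) (x : X' ~> X) :
  untranspose (k ∘ x) = untranspose k ∘ fmap F x.
Proof. by rewrite /untranspose fmap_comp compA. Qed.

Lemma untranspose_natr (X : C) (Y Y' : D) (k : X ~> G Y) (y : Y ~> Y') :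
  untranspose (fmap G y ∘ k) = y ∘ untranspose k.
Proof. by rewrite -[k in LHS]untransposeK transpose_natr transposeK. Qed.

End Transposition.

Arguments transpose {C D F G} adj {X Y} h.
Arguments untranspose {C D F G} adj {X Y} k.

Lemma adjunction_id (C : preadditive) :
  adjunction (functor_id C) (functor_id C).
Proof.
have nat_id (X Y : C) (g : X ~> Y) : idm Y ∘ g = g ∘ idm X.
  by rewrite comp1m compm1.
exists (@NatTrans _ _ (functor_id C)
         (functor_comp (functor_id C) (functor_id C)) (fun X => idm X) nat_id)
       (@NatTrans _ _
         (functor_comp (functor_id C) (functor_id C)) (functor_id C)
         (fun X => idm X) nat_id).
- by move=> X /=; rewrite comp1m.
- by move=> X /=; rewrite comp1m.
Qed.

Lemma adjunction_comp (C D E : preadditive) (F : functor C D) (G : functor D C)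
    (F' : functor D E) (G' : functor E D) :
  adjunction F G -> adjunction F' G' ->
  adjunction (functor_comp F' F) (functor_comp G G').
Proof.
move=> a b.
pose u (X : C) : X ~> G (G' (F' (F X))) :=
  transpose a (transpose b (idm (F' (F X)))).
pose c (Y : E) : F' (F (G (G' Y))) ~> Y :=
  untranspose b (untranspose a (idm (G (G' Y)))).
have u_nat (X Y : C) (g : X ~> Y) :
    u Y ∘ g = fmap G (fmap G' (fmap F' (fmap F g))) ∘ u X.
  by rewrite /u !(transpose_natl, transpose_natr) comp1m compm1.
have c_nat (X Y : E) (g : X ~> Y) :
    c Y ∘ fmap F' (fmap F (fmap G (fmap G' g))) = g ∘ c X.
  by rewrite /c -!(untranspose_natl, untranspose_natr) comp1m compm1.
exists (@NatTrans _ _ (functor_id C)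
         (functor_comp (functor_comp G G') (functor_comp F' F)) u u_nat)
       (@NatTrans _ _
         (functor_comp (functor_comp F' F) (functor_comp G G')) (functor_id E)
         c c_nat) => X /=.
- by rewrite /c /u -!untranspose_natl comp1m !transposeK.
- by rewrite /c /u !transpose_natr compm1 !untransposeK.
Qed.

(** The setting is a square of functors, commuting up to [theta]:
<<
           F
       C ------> D
     S |         | T
       v         v
       C1 -----> D1
           F1
>> *)
Section Mates.
Variables (C D C1 D1 : preadditive).
Variables (F : functor C D) (G : functor D C) (adj : adjunction F G).
Variables (F1 : functor C1 D1) (G1 : functor D1 C1) (adj1 : adjunction F1 G1).
Variables (S : functor C C1) (T : functor D D1).
Hypotheses (S_eqv : equivalence S) (T_eqv : equivalence T).
Variable theta : nat_iso (functor_comp F1 S) (functor_comp T F).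

Definition mate_map (Y : D) : S (G Y) ~> G1 (T Y) :=
  transpose adj1 (fmap T (adj_counit adj Y) ∘ iso_map (theta (G Y))).

Lemma mate_map_natural (Y Y' : D) (h : Y ~> Y') :
  mate_map Y' ∘ fmap S (fmap G h) = fmap G1 (fmap T h) ∘ mate_map Y.
Proof.
rewrite /mate_map transpose_natl transpose_natr.
have /= n := ni_natural theta (fmap G h).
have /= n' := nt_natural (adj_counit adj) h.
by rewrite -compA n !compA -!fmap_comp n'.
Qed.

Definition mate : nat_trans (functor_comp S G) (functor_comp G1 T) :=
  @NatTrans _ _ (functor_comp S G) (functor_comp G1 T) mate_map
    mate_map_natural.

(** Composition with [mate_map Y] on maps out of SX is, through [theta], the
    action of T on the transposes: Hom(X, GY) = Hom(FX, Y), which T carries to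
    Hom(TFX, TY) = Hom(F1 SX, TY) = Hom(SX, G1 TY).  Hence its injectivity and
    surjectivity reduce to S and T being fully faithful. *)
Lemma mate_map_fmap (X : C) (Y : D) (x : X ~> G Y) :
  mate_map Y ∘ fmap S x
    = transpose adj1 (fmap T (untranspose adj x) ∘ iso_map (theta X)).
Proof.
rewrite /mate_map transpose_natl /untranspose fmap_comp -!compA.
by have /= -> := ni_natural theta x.
Qed.

Lemma mate_map_inj (X : C) (Y : D) (x x' : S X ~> S (G Y)) :
  mate_map Y ∘ x = mate_map Y ∘ x' -> x = x'.
Proof.
have [y <-] := eqv_full S_eqv x; have [y' <-] := eqv_full S_eqv x'.
rewrite !mate_map_fmap => /(congr1 (untranspose adj1)); rewrite !transposeK.
move=> /(congr1 (fun z => z ∘ iso_inv (theta X))); rewrite !iso_invKr.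
move=> /(eqv_faithful T_eqv) /(congr1 (transpose adj)).
by rewrite !untransposeK => ->.
Qed.

Lemma mate_map_surj (X : C) (Y : D) (y : S X ~> G1 (T Y)) :
  exists x : S X ~> S (G Y), mate_map Y ∘ x = y.
Proof.
have [z zE] := eqv_full T_eqv (untranspose adj1 y ∘ iso_inv (theta X)).
exists (fmap S (transpose adj z)).
by rewrite mate_map_fmap transposeK zE iso_mapKr untransposeK.
Qed.

(** Every object of C1 is of the form SX up to isomorphism, so testing on maps
    out of these is enough, by the Yoneda argument. *)
Lemma mate_nat_iso : inhabited (nat_iso (functor_comp S G) (functor_comp G1 T)).
Proof.
apply: (@nat_iso_of_is_iso _ _ _ _ mate) => Y /=.
have [X [i]] := eqv_surj S_eqv (G1 (T Y)).
have [x xE] := mate_map_surj (iso_map i).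
have uv : mate_map Y ∘ (x ∘ iso_inv i) = idm (G1 (T Y)).
  by rewrite compA xE iso_invK.
exists (x ∘ iso_inv i); split=> //.
by apply: mate_map_inj; rewrite compA uv comp1m compm1.
Qed.

End Mates.

(** * Twisting by invertible objects *)

Section Twist.
Variable C : ttCategory.
Let laws := tt_laws C.

Lemma isomorphic_tens (X X' Y Y' : C) :
  isomorphic X X' -> isomorphic Y Y' -> isomorphic (X ⊗ Y) (X' ⊗ Y').
Proof.
move=> [i] [j]; split.
exists (iso_map i ⊠ iso_map j) (iso_inv i ⊠ iso_inv j).
- by rewrite -(tmap_comp laws) !iso_mapK (tmap_id laws).
- by rewrite -(tmap_comp laws) !iso_invK (tmap_id laws).
Qed.

Lemma isomorphic_tensC (X Y : C) : isomorphic (X ⊗ Y) (Y ⊗ X).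
Proof. by split; exact: braiding. Qed.

Lemma isomorphic_tensA (X Y Z : C) :
  isomorphic ((X ⊗ Y) ⊗ Z) (X ⊗ (Y ⊗ Z)).
Proof. by split; exact: associator. Qed.

Lemma isomorphic_tens1 (X : C) : isomorphic (X ⊗ 𝟙) X.
Proof. by split; exact: unitorr. Qed.

Lemma isomorphic_1tens (X : C) : isomorphic (𝟙 ⊗ X) X.
Proof. by split; exact: unitorl. Qed.

Lemma twist_id (P X : C) : idm X ⊠ idm P = idm (X ⊗ P).
Proof. exact: (tmap_id laws). Qed.

Lemma twist_comp (P X Y Z : C) (g : Y ~> Z) (f : X ~> Y) :
  (g ∘ f) ⊠ idm P = (g ⊠ idm P) ∘ (f ⊠ idm P).
Proof. by rewrite -(tmap_comp laws) comp1m. Qed.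

Definition twist (P : C) : functor C C :=
  @Functor C C (fun X => X ⊗ P) (fun _ _ f => f ⊠ idm P)
    (twist_id P) (@twist_comp P).

Lemma twistK (P Q : C) : isomorphic (P ⊗ Q) 𝟙 ->
  inhabited (nat_iso (functor_comp (twist Q) (twist P)) (functor_id C)).
Proof.
case=> i.
pose c (X : C) : functor_comp (twist Q) (twist P) X ~> functor_id C X :=
  iso_map (unitorr (tt_mon C) X) ∘ (idm X ⊠ iso_map i)
    ∘ iso_map (associator (tt_mon C) X P Q).
have c_nat (X Y : C) (f : X ~> Y) :
    c Y ∘ fmap (functor_comp (twist Q) (twist P)) f
      = fmap (functor_id C) f ∘ c X.
  rewrite /c /= -compA (associator_natural laws) (tmap_id laws).
  rewrite !compA -(unitorr_natural laws).
  congr (_ ∘ _); rewrite -!compA; congr (_ ∘ _).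
  by rewrite -!(tmap_comp laws) !comp1m !compm1.
apply: (@nat_iso_of_is_iso _ _ _ _ (NatTrans c_nat)) => X /=.
exists (iso_inv (associator (tt_mon C) X P Q) ∘ (idm X ⊠ iso_inv i)
          ∘ iso_inv (unitorr (tt_mon C) X)).
rewrite /c; split.
- rewrite !compA iso_mapKr -(compA _ (idm X ⊠ iso_inv i)) -(tmap_comp laws).
  by rewrite iso_mapK comp1m (tmap_id laws) compm1 iso_mapK.
- rewrite !compA iso_invKr -(compA _ (idm X ⊠ iso_map i)) -(tmap_comp laws).
  by rewrite iso_invK comp1m (tmap_id laws) compm1 iso_invK.
Qed.

Lemma twist_equivalence (P : C) : invertible P -> equivalence (twist P).
Proof.
case=> Q PQ.
have QP := isomorphic_trans (isomorphic_tensC Q P) PQ.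
have [a] := twistK PQ; have [b] := twistK QP.
exact: quasi_inverse_equivalence a b.
Qed.

End Twist.

Section GeometricTwist.
Variables (C D : ttCategory) (f : geometric_functor C D).

Lemma geom_unit : isomorphic (f 𝟙) 𝟙.
Proof. by apply: isomorphic_sym; split; exact: mon_unit (geom_monoidal f). Qed.

Lemma geom_tens (X Y : C) : isomorphic (f X ⊗ f Y) (f (X ⊗ Y)).
Proof. by split; exact: mon_tens (geom_monoidal f) X Y. Qed.

Lemma geom_invertible (P : C) : invertible P -> invertible (f P).
Proof.
case=> Q PQ; exists (f Q); apply: isomorphic_trans (geom_tens P Q) _.
exact: isomorphic_trans (isomorphic_fobj f PQ) geom_unit.
Qed.

Lemma geom_twist (P : C) :
  nat_iso (functor_comp f (twist P)) (functor_comp (twist (f P)) f).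
Proof.
exists (fun X => iso_sym (mon_tens (geom_monoidal f) X P)) => X Y g /=.
set m := mon_tens (geom_monoidal f).
have n := mon_natural (geom_monoidal f) g (idm P).
rewrite -/m fmap_id in n.
by rewrite -(iso_mapKl (m Y P) (fmap f g ⊠ _)) n -!compA iso_invK compm1.
Qed.

Variables (f_ : functor D C) (f_sh : functor C D).
Hypotheses (adj_f : adjunction f f_) (adj_f_sh : adjunction f_ f_sh).

(** The first mate is the projection formula f_*(A ⊗ f^*P) ≅ f_*A ⊗ P; its own
    mate, with respect to f_* ⊣ f^!, is the formula sought. *)
Lemma shriek_twist (P Y : C) : invertible P ->
  isomorphic (f_sh (Y ⊗ P)) (f_sh Y ⊗ f P).
Proof.
move=> P_inv.
have P_eqv := twist_equivalence P_inv.
have fP_eqv := twist_equivalence (geom_invertible P_inv).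
have [proj] := mate_nat_iso adj_f adj_f P_eqv fP_eqv (geom_twist P).
have inv_proj : nat_iso (functor_comp f_ (twist (f P)))
    (functor_comp (twist P) f_).
  exists (fun X => iso_sym (proj X)) => X X' g /=.
  have /= n := ni_natural proj g.
  by rewrite -(iso_invKr (proj X) (fmap f_ _)) -n !compA iso_mapK comp1m.
have [i] := mate_nat_iso adj_f_sh adj_f_sh fP_eqv P_eqv inv_proj.
by apply: isomorphic_sym; split; exact: i Y.
Qed.

End GeometricTwist.

(** * Torsion objects *)

Section Torsion.
Variables (C D : ttCategory) (f : geometric_functor C D).
Variables (f_ : functor D C) (f_sh : functor C D).
Hypotheses (adj_f : adjunction f f_) (adj_f_sh : adjunction f_ f_sh).
Variables (Gamma : functor C (torsion f_)).
Hypothesis adj_Gamma : adjunction (torsion_incl f_) Gamma.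

Lemma Loc_tens_twist (E : C -> Prop) (P X : C) :
  Loc_tens E X -> Loc_tens E (X ⊗ P).
Proof.
move=> EX L L_loc L_tens EL.
apply: (sub_iso (proj1 L_loc) (isomorphic_tensC P X)).
exact: (L_tens _ _ (EX L L_loc L_tens EL)).
Qed.

Definition torsion_twist (P : C) : functor (torsion f_) (torsion f_) :=
  @Functor (torsion f_) (torsion f_)
    (fun X => exist _ (sval X ⊗ P) (Loc_tens_twist P (svalP X)))
    (fun X Y g => g ⊠ idm P)
    (fun X => twist_id P (sval X))
    (fun X Y Z g h => twist_comp P g h).

(** For Y torsion and Q inverse to P, the preimage Y ⊗ Q of Y is again
    torsion. *)
Lemma torsion_twist_equivalence (P : C) :
  invertible P -> equivalence (torsion_twist P).
Proof.
move=> P_inv; have P_eqv := twist_equivalence P_inv.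
split=> [X Y g h | X Y h | Y].
- exact: (eqv_faithful P_eqv).
- exact: (@eqv_full _ _ _ P_eqv (sval X) (sval Y) h).
- have [Q PQ] := P_inv.
  have [a] := twistK (isomorphic_trans (isomorphic_tensC Q P) PQ).
  have [m m' m'm mm'] := a (sval Y).
  pose A : torsion f_ := exist _ (sval Y ⊗ Q) (Loc_tens_twist Q (svalP Y)).
  exists A; split.
  exact: (@Iso (torsion f_) (torsion_twist P A) Y m m' m'm mm').
Qed.

Lemma Gamma_twist (P Y : C) : invertible P ->
  isomorphic (torsion_twist P (Gamma Y)) (Gamma (Y ⊗ P)).
Proof.
move=> P_inv.
have theta : nat_iso (functor_comp (torsion_incl f_) (torsion_twist P))
    (functor_comp (twist P) (torsion_incl f_)).
  have id_id (X : C) : idm (X ⊗ P) ∘ idm (X ⊗ P) = idm (X ⊗ P).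
    exact: comp1m.
  exists (fun X => Iso (id_id (sval X)) (id_id (sval X))).
  by move=> X X' g /=; rewrite comp1m compm1.
have [i] := mate_nat_iso adj_Gamma adj_Gamma
  (torsion_twist_equivalence P_inv) (twist_equivalence P_inv) theta.
by split; exact: i Y.
Qed.

Lemma isomorphic_Gamma_twist (P Y Z : C) : invertible P ->
  isomorphic (Gamma Y) (Gamma Z) -> isomorphic (Gamma (Y ⊗ P)) (Gamma (Z ⊗ P)).
Proof.
move=> P_inv YZ.
apply: isomorphic_trans (isomorphic_sym (Gamma_twist Y P_inv)) _.
exact: isomorphic_trans (isomorphic_fobj _ YZ) (Gamma_twist Z P_inv).
Qed.

(** f_* is lax monoidal, hence f_*A is a module over the ring f_*𝟙: the unit of
    the ring gives [s], the action gives [r], and the unit law is [r ∘ s = id].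
    Both structure maps are transposes, so the law is checked after transposing,
    where it becomes the compatibility of f^* with the left unitors. *)
Lemma pushforward_retract (A : D) :
  exists (s : f_ A ~> f_ 𝟙 ⊗ f_ A) (r : f_ 𝟙 ⊗ f_ A ~> f_ A),
    r ∘ s = idm (f_ A).
Proof.
have lD := tt_laws D.
set m := geom_monoidal f; set c := adj_counit adj_f.
pose e : 𝟙 ~> f_ 𝟙 := transpose adj_f (iso_inv (mon_unit m)).
exists ((e ⊠ idm (f_ A)) ∘ iso_inv (unitorl (tt_mon C) (f_ A))).
exists (transpose adj_f (iso_map (unitorl (tt_mon D) A) ∘ (c 𝟙 ⊠ c A)
          ∘ iso_inv (mon_tens m (f_ 𝟙) (f_ A)))).
rewrite transpose_natl -[RHS](untransposeK adj_f).
apply: (congr1 (transpose adj_f)).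
rewrite /untranspose fmap_id compm1 -/c.
set X := f_ A.
have ce : c 𝟙 ∘ fmap f e = iso_inv (mon_unit m) by exact: transposeK.
have n := mon_natural m e (idm X); rewrite fmap_id in n.
(* [mon_unitl] solved for the unitor of D, with both sides inverted *)
have ul : iso_inv (unitorl (tt_mon D) (f X))
    = (iso_inv (mon_unit m) ⊠ idm (f X)) ∘ iso_inv (mon_tens m 𝟙 X)
        ∘ fmap f (iso_inv (unitorl (tt_mon C) X)).
  set v := RHS; rewrite -[v](iso_mapKl (unitorl (tt_mon D) (f X))).
  rewrite -(mon_unitl m) /v -!compA.
  rewrite (compA (iso_map (mon_unit m) ⊠ _)) -(tmap_comp lD) iso_invK comp1m.
  rewrite (tmap_id lD) comp1m iso_invKl -fmap_comp iso_invK fmap_id.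
  by rewrite compm1.
have -> : fmap f ((e ⊠ idm X) ∘ iso_inv (unitorl (tt_mon C) X))
    = iso_map (mon_tens m (f_ 𝟙) X) ∘ (fmap f e ⊠ idm (f X))
        ∘ iso_inv (mon_tens m 𝟙 X)
        ∘ fmap f (iso_inv (unitorl (tt_mon C) X)).
  by rewrite n iso_invKr fmap_comp.
rewrite -!compA iso_mapKl (compA (c 𝟙 ⊠ c A)) -(tmap_comp lD) ce compm1.
rewrite -[iso_inv (mon_unit m)]comp1m -[c A]compm1 (tmap_comp lD) -!compA.
rewrite (compA (iso_inv (mon_unit m) ⊠ _)) -ul compA (unitorl_natural lD).
by rewrite iso_invKr compm1.
Qed.

(** The counit c : Gamma Y -> Y induces bijections on maps out of torsion
    objects, hence on maps out of their retracts, hence on maps out of every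
    f_*A by [pushforward_retract].  Through f_* ⊣ f^! this is the hypothesis of
    the Yoneda argument for f^!c. *)
Lemma shriek_Gamma (Y : C) : isomorphic (f_sh (sval (Gamma Y))) (f_sh Y).
Proof.
pose c : sval (Gamma Y) ~> Y := adj_counit adj_Gamma Y.
pose T (A : D) : torsion f_ :=
  exist _ (f_ 𝟙 ⊗ f_ A) (Loc_tens_twist (f_ A) (fun L _ _ EL => EL _ erefl)).
have c_inj (A : D) (x x' : f_ A ~> sval (Gamma Y)) : c ∘ x = c ∘ x' -> x = x'.
  have [s [r rs]] := pushforward_retract A => e.
  rewrite -[x]compm1 -[x']compm1 -rs !compA; congr (_ ∘ s).
  apply: (can_inj (@untransposeK _ _ _ _ adj_Gamma (T A) Y)).
  by rewrite /untranspose /= !compA e.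
have c_surj (A : D) (y : f_ A ~> Y) :
    exists x : f_ A ~> sval (Gamma Y), c ∘ x = y.
  have [s [r rs]] := pushforward_retract A.
  pose x : f_ 𝟙 ⊗ f_ A ~> sval (Gamma Y) :=
    @transpose _ _ _ _ adj_Gamma (T A) Y (y ∘ r).
  have cx : c ∘ x = y ∘ r by exact: (@transposeK _ _ _ _ adj_Gamma (T A) Y).
  by exists (x ∘ s); rewrite compA cx -compA rs compm1.
have [x cx] := c_surj _ (adj_counit adj_f_sh Y).
pose v := transpose adj_f_sh x.
have cv : fmap f_sh c ∘ v = idm (f_sh Y).
  by rewrite transpose_natr cx /transpose adj_triangleR.
apply: (@is_iso_isomorphic _ _ _ (fmap f_sh c)); exists v; split=> //.
apply: (can_inj (@untransposeK _ _ _ _ adj_f_sh _ _)); apply: c_inj.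
by rewrite -!untranspose_natr compA cv comp1m compm1.
Qed.

Lemma isomorphic_shriek_Gamma (Y Z : C) :
  isomorphic (Gamma Y) (Gamma Z) -> isomorphic (f_sh Y) (f_sh Z).
Proof.
move=> YZ; apply: isomorphic_trans (isomorphic_sym (shriek_Gamma Y)) _.
apply: isomorphic_trans (shriek_Gamma Z).
exact: (isomorphic_fobj f_sh (isomorphic_fobj (torsion_incl f_) YZ)).
Qed.

End Torsion.

(** * Geometric sections *)

(** Right adjoints of f^* eta^* ≅ id give id ≅ eta_* f_*, whose right adjoints
    give f^! eta^! ≅ id.  Both steps are mates along identity functors, which is
    the uniqueness of adjoints. *)
Lemma shriek_section (C D : ttCategory)
    (f : geometric_functor C D) (f_ : functor D C) (f_sh : functor C D)
    (adj_f : adjunction f f_) (adj_f_sh : adjunction f_ f_sh)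
    (eta : geometric_functor D C) (eta_ : functor C D) (eta_sh : functor D C)
    (adj_eta : adjunction eta eta_) (adj_eta_sh : adjunction eta_ eta_sh)
    (eta_section : geometric_section f eta) (Y : D) :
  isomorphic (f_sh (eta_sh Y)) Y.
Proof.
have [a] := eta_section.
have id_eqv := equivalence_id D.
pose theta := @NatIso _ _ (functor_comp (functor_comp f eta) (functor_id D))
  (functor_comp (functor_id D) (functor_id D)) (ni_iso a) (@ni_natural _ _ _ _ a).
have [b] := mate_nat_iso (adjunction_id D) (adjunction_comp adj_eta adj_f)
  id_eqv id_eqv theta.
pose theta' := @NatIso _ _ (functor_comp (functor_id D) (functor_id D))
  (functor_comp (functor_id D) (functor_comp eta_ f_)) (ni_iso b)
  (@ni_natural _ _ _ _ b).
have [c] := mate_nat_iso (adjunction_comp adj_f_sh adj_eta_sh) (adjunction_id D)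
  id_eqv id_eqv theta'.
by split; exact: c Y.
Qed.

Theorem theorem5 (C D : ttCategory)
    (hC : rigidly_compactly_generated C) (hD : rigidly_compactly_generated D)
    (f : geometric_functor C D) (f_ : functor D C) (f_sh : functor C D)
    (adj_f : adjunction f f_) (adj_f_sh : adjunction f_ f_sh)
    (Gamma : functor C (torsion f_)) (adj_Gamma : adjunction (torsion_incl f_) Gamma)
    (eta : geometric_functor D C) (eta_ : functor C D) (eta_sh : functor D C)
    (adj_eta : adjunction eta eta_) (adj_eta_sh : adjunction eta_ eta_sh)
    (f_Gorenstein : Gorenstein f_sh) (f_proxy : proxy_small_functor f_)
    (eta_section : geometric_section f eta) :
  Gorenstein_duality Gamma eta eta_sh <->
  orientable_Matlis_lift f_sh Gamma (eta_sh (omega f_sh)).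
Proof.
have lift := shriek_section adj_f adj_f_sh adj_eta adj_eta_sh eta_section.
have f_eta (X : D) : isomorphic (f (eta X)) X.
  by have [a] := eta_section; split; exact: a.
have eta_omega : isomorphic (eta_sh (omega f_sh))
    (omega eta_sh ⊗ eta (omega f_sh)).
  apply: isomorphic_trans (shriek_twist adj_eta adj_eta_sh 𝟙 f_Gorenstein).
  exact: (isomorphic_fobj eta_sh
    (isomorphic_sym (isomorphic_1tens (omega f_sh)))).
have eta_omega_inv := geom_invertible eta f_Gorenstein.
split=> [[X [X_inv dual_X]] | [_ orient]].
- split; first exact: lift.
  (* Apply f^! to the duality isomorphism. *)
  have omegaX : isomorphic (omega f_sh ⊗ X) 𝟙.
    apply: isomorphic_trans (lift 𝟙).
    apply: isomorphic_sym.
    apply: isomorphic_trans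
      (isomorphic_shriek_Gamma adj_f adj_f_sh adj_Gamma dual_X) _.
    apply: isomorphic_trans
      (isomorphic_fobj f_sh (isomorphic_sym (isomorphic_1tens _))) _.
    apply: isomorphic_trans
      (shriek_twist adj_f adj_f_sh 𝟙 (geom_invertible eta X_inv)) _.
    exact: isomorphic_tens (isomorphic_refl _) (f_eta X).
  apply: isomorphic_trans (isomorphic_fobj Gamma eta_omega) _.
  apply: isomorphic_trans
    (isomorphic_Gamma_twist adj_Gamma eta_omega_inv dual_X) _.
  apply: isomorphic_fobj; apply: isomorphic_trans (geom_tens eta _ _) _.
  apply: isomorphic_trans (geom_unit eta); apply: isomorphic_fobj.
  exact: isomorphic_trans (isomorphic_tensC X _) omegaX.
- have [W omegaW] := f_Gorenstein.
  have W_inv : invertible W.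
    exists (omega f_sh).
    exact: isomorphic_trans (isomorphic_tensC W _) omegaW.
  exists W; split=> //.
  (* Twist the orientation by eta^*W, which cancels eta^*(omega_f). *)
  have /(isomorphic_Gamma_twist adj_Gamma (geom_invertible eta W_inv)) :=
    isomorphic_trans (isomorphic_fobj Gamma (isomorphic_sym eta_omega)) orient.
  move/isomorphic_trans/(_ (isomorphic_fobj Gamma (isomorphic_1tens _))).
  apply: isomorphic_trans; apply: isomorphic_fobj; apply: isomorphic_sym.
  apply: isomorphic_trans (isomorphic_tensA _ _ _) _.
  apply: isomorphic_trans (isomorphic_tens1 _).
  apply: isomorphic_tens (isomorphic_refl _) _.
  apply: isomorphic_trans (geom_tens eta _ _) _.
  exact: isomorphic_trans (isomorphic_fobj eta omegaW) (geom_unit eta).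
Qed.
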